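(* Let $A$ be a unital C$^*$-algebra and let $T:A\to A$ be a continuous linear map which is a triple derivation at $1$. Then $T$ is a triple derivation.
   Context: For $a,b,c\in A$, $\{a,b,c\}=\frac12(ab^*c+cb^*a)$. A linear map $T:A\to A$ is a triple derivation at $z\in A$ if for all $a,b,c\in A$ with $\{a,b,c\}=z$ one has $T(z)=\{T(a),b,c\}+\{a,T(b),c\}+\{a,b,T(c)\}$. A triple derivation on $A$ is a linear map $\delta:A\to A$ with $\delta\{a,b,c\}=\{\delta(a),b,c\}+\{a,\delta(b),c\}+\{a,b,\delta(c)\}$ for all $a,b,c\in A$. *)

(* Defs.v *)
From HB Require Import structures.
From mathcomp Require Import all_boot all_order all_algebra.
From mathcomp Require Import complex.
From mathcomp Require Import all_classical all_reals all_analysis.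

Set Implicit Arguments.
Unset Strict Implicit.
Unset Printing Implicit Defensive.

Import Order.TTheory GRing.Theory Num.Theory.
Import numFieldNormedType.Exports.

Local Open Scope ring_scope.
Local Open Scope complex_scope.

(* Unital C*-algebras over R[i], the complex numbers; 1 = 0 is allowed.
   Hierarchy-Builder cannot join a normed module with a ring structure, because
   the existing join of these two hierarchies is [numDomainType]. Hence this
   record adds the multiplication, the unit and the involution to a Banach
   space, and the instances below make the usual notations available.
   The norm of a normed module over R[i] takes its values in R[i], in which
   x <= y means that y - x is real and nonnegative. *)
Record cstarAlgType (R : realType) := CStarAlgType {
  cstar_banach : completeNormedModType R[i] ;
  cstar_one : cstar_banach ;
  cstar_mul : cstar_banach -> cstar_banach -> cstar_banach ;
  cstar_star : cstar_banach -> cstar_banach ;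
  cstar_mulA : associative cstar_mul ;
  cstar_mul1r : left_id cstar_one cstar_mul ;
  cstar_mulr1 : right_id cstar_one cstar_mul ;
  cstar_mulDl : left_distributive cstar_mul +%R ;
  cstar_mulDr : right_distributive cstar_mul +%R ;
  cstar_scaleAl : forall (k : R[i]) a b,
    k *: cstar_mul a b = cstar_mul (k *: a) b ;
  cstar_scaleAr : forall (k : R[i]) a b,
    k *: cstar_mul a b = cstar_mul a (k *: b) ;
  cstar_norm_mul : forall a b, `|cstar_mul a b| <= `|a| * `|b| ;
  cstar_starK : involutive cstar_star ;
  cstar_starD : {morph cstar_star : a b / a + b} ;
  cstar_starZ : forall (k : R[i]) a,
    cstar_star (k *: a) = (k^*)%R *: cstar_star a ;
  cstar_starM : forall a b,
    cstar_star (cstar_mul a b) = cstar_mul (cstar_star b) (cstar_star a) ;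
  cstar_norm_star : forall a, `|cstar_mul (cstar_star a) a| = `|a| ^+ 2
}.

Definition cstar_sort (R : realType) (A : cstarAlgType R) : Type :=
  cstar_banach A.

Coercion cstar_sort : cstarAlgType >-> Sortclass.

HB.instance Definition _ (R : realType) (A : cstarAlgType R) :=
  CompleteNormedModule.copy (cstar_sort A) (cstar_banach A).

HB.instance Definition _ (R : realType) (A : cstarAlgType R) :=
  GRing.Zmodule_isPzRing.Build (cstar_sort A)
    (@cstar_mulA R A) (@cstar_mul1r R A) (@cstar_mulr1 R A)
    (@cstar_mulDl R A) (@cstar_mulDr R A).

Definition star (R : realType) (A : cstarAlgType R) (a : A) : A :=
  @cstar_star R A a.

Section CStarTheory.
Variables (R : realType) (A : cstarAlgType R).
Implicit Types (k : R[i]) (a b : A).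

Lemma cstar_scalerAl k a b : k *: (a * b) = (k *: a) * b.
Proof. exact: cstar_scaleAl. Qed.

Lemma cstar_scalerAr k a b : k *: (a * b) = a * (k *: b).
Proof. exact: cstar_scaleAr. Qed.

Lemma cstar_normrM a b : `|a * b| <= `|a| * `|b|.
Proof. exact: cstar_norm_mul. Qed.

Lemma starK : involutive (@star R A).
Proof. exact: cstar_starK. Qed.

Lemma starD : {morph @star R A : a b / a + b}.
Proof. exact: cstar_starD. Qed.

Lemma starZ k a : star (k *: a) = (k^*)%R *: star a.
Proof. exact: cstar_starZ. Qed.

Lemma starM a b : star (a * b) = star b * star a.
Proof. exact: cstar_starM. Qed.

Lemma cstar_identity a : `|star a * a| = `|a| ^+ 2.
Proof. exact: cstar_norm_star. Qed.

End CStarTheory.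

Definition triple_product (R : realType) (A : cstarAlgType R) (a b c : A) : A :=
  (2^-1 : R[i]) *: (a * star b * c + c * star b * a).

Definition triple_derivation_at (R : realType) (A : cstarAlgType R)
    (T : {linear A -> A}) (z : A) : Prop :=
  forall a b c : A, triple_product a b c = z ->
    T z = triple_product (T a) b c + triple_product a (T b) c
          + triple_product a b (T c).

Definition triple_derivation (R : realType) (A : cstarAlgType R)
    (d : {linear A -> A}) : Prop :=
  forall a b c : A,
    d (triple_product a b c) =
      triple_product (d a) b c + triple_product a (d b) c
      + triple_product a b (d c).

(* Main.v *)
Require Import Defs.
From HB Require Import structures.
From mathcomp Require Import all_boot all_order all_algebra.
From mathcomp Require Import complex ring.
From mathcomp Require Import all_classical all_reals all_analysis.

Import numFieldNormedType.Exports.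
Import Order.TTheory GRing.Theory Num.Theory.

Local Open Scope ring_scope.

Set Implicit Arguments.
Unset Strict Implicit.
Unset Printing Implicit Defensive.

(** Write x o y = (xy + yx)/2 and h = T(1). The relation {1,1,1} = 1 gives
    h* = -h. For a skew-adjoint h the map x |-> h o x is a triple derivation
    ([inner_leibniz]), so T may be replaced by D = T - h o (-), which is again
    bounded and a triple derivation at 1, and which satisfies D(1) = 0.

    Let a be invertible. The relations {a,1,a^-1} = 1 and {a,(a^-1)*,1} = 1 give
      D(a) o a^-1 + a o D(a^-1) = 0,
      D(a) o a^-1 + a o D((a^-1)* )* = 0.
    Exchange a and a^-1, compare the two, and multiply by a on both sides: the
    difference u = D(a* )* - D(a) satisfies a o u = 0, which forces u = 0 when a
    is within 1/2 of 1. By linearity D commutes with the involution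
    ([at1_star]).

    Now put a = 1 - y with y small in the first relation; a is invertible by
    completeness ([neumann]). Since a^-1 = 1 + y + y^2 + O(y^3) and D is bounded,
    the terms of second order give D(y^2) - 2 D(y) o y = O(y^3). The left-hand
    side is homogeneous of degree 2, so it vanishes: D is a Jordan derivation
    ([at1_jordan]). Finally, the triple product can be written with the Jordan
    product and the involution,
      {a,b,c} = (a o b* ) o c + (b* o c) o a - (a o c) o b*,
    so D is a triple derivation ([jordan_derivation_leibniz]), and so is T.

    To avoid factors 1/2, the doubled products [jordan x y] = xy + yx and
    [triple_sum x y z] = xyz + zyx are used; the latter has no involution. *)

(** * Inverses near the unit and vanishing of homogeneous maps *)

Local Open Scope classical_set_scope.

Lemma complex_div_expn2_lt (R : realType) (c e : R[i]) :
  0 <= c -> 0 < e -> exists n, c / 2 ^+ n < e.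
Proof.
move=> c0 e0.
have : 0 <= c / e by rewrite divr_ge0 // ltW.
case E : (c / e) => [r s]; rewrite lecE /= => /andP[/eqP s0 r0].
exists (Num.bound r).
rewrite ltr_pdivrMr ?exprn_gt0 // mulrC -ltr_pdivrMr // E s0.
have -> : (2 : R[i]) ^+ Num.bound r = ((2 ^ Num.bound r)%:R : R)%:C%C.
  by rewrite rmorph_nat natrX.
rewrite (_ : (r +i* 0)%C = r%:C%C) // ltcR.
apply: lt_trans (archi_boundP r0) _.
by rewrite ltr_nat ltn_expl.
Qed.

(** The contraction principle for a norm with values in R[i]; the factor 1/2 is
    all that the Neumann series needs. *)
Lemma halving_map_fixpoint (R : realType) (V : completeNormedModType R[i])
    (f : V -> V) :
  (forall u v, `|f u - f v| <= `|u - v| / 2) -> exists s, s = f s.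
Proof.
move=> hf.
have pow2_gt0 n : 0 < (2 : R[i]) ^+ n by rewrite exprn_gt0.
have iter_contract n u v : `|iter n f u - iter n f v| <= `|u - v| / 2 ^+ n.
  elim: n => [|n IH] /=; first by rewrite expr0 divr1.
  apply: le_trans (hf _ _) _.
  by rewrite exprSr invfM mulrA ler_pM2r // invr_gt0.
have iter_bound m : `|iter m f 0| <= `|f 0| * 2.
  elim: m => [|m IH] /=; first by rewrite normr0 mulr_ge0.
  have -> : f (iter m f 0) = (f (iter m f 0) - f 0) + f 0 by rewrite subrK.
  apply: le_trans (ler_normD _ _) _; rewrite [leRHS]mulr_natr mulr2n lerD2r.
  by apply: le_trans (hf _ _) _; rewrite subr0 ler_pdivrMr.
(* f^n 0 = f^N (f^(n - N) 0), and the orbit of 0 is bounded. *)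
have dist N n : (N <= n)%N -> `|iter N f 0 - iter n f 0| <= `|f 0| * 2 / 2 ^+ N.
  move=> Nn; rewrite -{1}(subnKC Nn) iterD.
  apply: le_trans (iter_contract _ _ _) _.
  by rewrite ler_pM2r ?invr_gt0 // sub0r normrN.
have cvgs : cvg (iter n f 0 @[n --> \oo]).
  apply/cauchy_cvgP/cauchyP => e e0.
  have [N hN] := complex_div_expn2_lt (mulr_ge0 (normr_ge0 (f 0)) (ler0n _ 2)) e0.
  exists (iter N f 0); exists N => // n /= Nn.
  by rewrite -ball_normE /=; apply: le_lt_trans (dist _ _ Nn) hN.
exists (lim (iter n f 0 @[n --> \oo])).
set s := lim _.
have cf : continuous f.
  move=> u; apply/cvgrPdist_le => e e0.
  near=> v.
  apply: le_trans (hf _ _) _; rewrite ler_pdivrMr //.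
  apply: (@le_trans _ _ e); last by rewrite ler_peMr ?ler1n // ltW.
  by near: v; apply: cvgr_dist_le.
apply: (@cvg_unique _ (@norm_hausdorff _ V) (iter n f 0 @[n --> \oo])).
  exact: cvgs.
move: (@cvg_shiftS V (fun n => iter n f 0) (nbhs (f s))) => /= <-.
by apply: (@cvg_comp _ _ _ (fun n => iter n f 0) f); [exact: cvgs | exact: cf].
Unshelve. all: by end_near. Qed.

(** A right inverse of 1 - y is a fixed point of u |-> 1 + yu, a left inverse one
    of u |-> 1 + uy; both maps are contractions, and the two inverses agree. The
    bound on r follows from r = 1 + yr. *)
Lemma neumann (R : realType) (A : cstarAlgType R) (y : A) :
  `|y| <= 2^-1 ->
  exists r : A, [/\ (1 - y) * r = 1, r * (1 - y) = 1 & `|r| <= `|1 : A| * 2].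
Proof.
move=> hy.
have half (u : A) : `|y| * `|u| <= `|u| / 2 by rewrite mulrC ler_wpM2l.
have [|r rE] := @halving_map_fixpoint R A (fun u : A => 1 + y * u).
  move=> u v; rewrite opprD addrACA subrr add0r -mulrBr.
  by apply: le_trans (cstar_normrM _ _) (half _).
have [|l lE] := @halving_map_fixpoint R A (fun u : A => 1 + u * y).
  move=> u v; rewrite opprD addrACA subrr add0r -mulrBl.
  by apply: le_trans (cstar_normrM _ _) _; rewrite mulrC half.
have rK : (1 - y) * r = 1.
  by rewrite mulrBl mul1r {1}rE addrK.
have lK : l * (1 - y) = 1.
  by rewrite mulrBr mulr1 {1}lE addrK.
have lr : l = r by rewrite -[l]mulr1 -rK mulrA lK mul1r.
exists r; split=> //; first by rewrite -lr.
have : `|r| <= `|1 : A| + `|r| / 2.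
  rewrite {1}rE; apply: le_trans (ler_normD _ _) _; rewrite lerD2l.
  exact: le_trans (cstar_normrM _ _) (half _).
rewrite -lerBlDr {1}[ `|r| ](splitr) addrK.
by rewrite ler_pdivrMr.
Qed.

Lemma norm_le_small_eq0 (R : realType) (V : normedModType R[i])
    (u : V) (t0 K : R[i]) :
  0 < t0 -> 0 <= K -> (forall t, 0 < t -> t <= t0 -> `|u| <= K * t) -> u = 0.
Proof.
move=> t0_gt0 K0 hu; apply/eqP; rewrite -normr_eq0; apply/negPn/negP => u0.
have up : 0 < `|u| by rewrite lt0r u0 normr_ge0.
have sp : 0 < `|u| + K * t0 by rewrite ltr_wpDr // mulr_ge0 // ltW.
(* This t is below t0 and makes K * t strictly smaller than the norm of u. *)
have t0le : t0 * `|u| / (`|u| + K * t0) <= t0.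
  by rewrite ler_pdivrMr // ler_pM2l // lerDl mulr_ge0 // ltW.
have := hu _ (divr_gt0 (mulr_gt0 t0_gt0 up) sp) t0le.
rewrite mulrA ler_pdivlMr // mulrA [K * t0 * _]mulrC ler_pM2l //.
by rewrite gerDr normr_le0 -normr_eq0 (negPf u0).
Qed.

(** This replaces the comparison of coefficients in a power series: a
    homogeneous map of degree k has no room for a remainder of order k + 1. *)
Lemma homogeneous_vanish (R : realType) (V W : normedModType R[i])
    (k : nat) (G : V -> W) (K : R[i]) :
  0 <= K -> (forall (t : R[i]) x, G (t *: x) = t ^+ k *: G x) ->
  (forall y, `|y| <= 2^-1 -> `|G y| <= K * `|y| ^+ k.+1) ->
  forall x, G x = 0.
Proof.
move=> K0 Gh GO x.
have x1 : 0 < `|x| + 1 by rewrite ltr_wpDl.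
apply: (@norm_le_small_eq0 R W (G x) (2^-1 / (`|x| + 1)) (K * `|x| ^+ k.+1)).
- by rewrite divr_gt0.
- by rewrite mulr_ge0 // exprn_ge0.
move=> t tp; rewrite ler_pdivlMr // => ht.
have : `|t *: x| <= 2^-1.
  rewrite normrZ gtr0_norm //; apply: le_trans ht.
  by rewrite ler_pM2l // lerDl.
move/GO; rewrite Gh !normrZ gtr0_norm ?exprn_gt0 //.
rewrite (gtr0_norm tp) exprMn exprSr.
rewrite -mulrA [leRHS]mulrCA ler_pM2l ?exprn_gt0 //.
by rewrite -mulrA [_ ^+ _ * t]mulrC.
Qed.

Lemma small_multiple (R : realType) (V : normedModType R[i]) (x : V) :
  exists2 t : R[i], t != 0 & `|t *: x| <= 2^-1.
Proof.
have x1 : 0 < `|x| + 1 by rewrite ltr_wpDl.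
exists (2^-1 / (`|x| + 1)); first by rewrite gt_eqF // divr_gt0.
rewrite normrZ gtr0_norm ?divr_gt0 // -mulrA ler_piMr //.
by rewrite mulrC ler_pdivrMr // mul1r lerDl.
Qed.

Local Close Scope classical_set_scope.

(** * Rearrangements of sums *)

Lemma addr_double3 (V : nmodType) (p q r : V) :
  p + p + (q + q) + (r + r) = p + q + r + (p + q + r).
Proof. by rewrite [RHS]addrACA (addrACA p). Qed.

Lemma addrB3 (V : zmodType) (p q r p' q' r' : V) :
  (p - p') + (q - q') + (r - r') = (p + q + r) - (p' + q' + r').
Proof. by rewrite !opprD [RHS]addrACA (addrACA p). Qed.

Lemma addr_alternating (V : zmodType) (p q r p' q' r' : V) :
  (p - q + r) + (r' - q' + p') = (p + p') - (q + q') + (r + r').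
Proof. by rewrite opprD !addrA (ACl (1*6*2*5*3*4)). Qed.

Lemma addr_leibniz9 (V : zmodType) (x1 x2 x3 y1 y2 y3 z1 z2 z3 : V) :
  x1 + x2 + x3 + (y1 + y2 + y3) - (z1 + z2 + z3) =
  (x1 + y3 - z1) + (x2 + y1 - z3) + (x3 + y2 - z2).
Proof. by rewrite !opprD !addrA [LHS](ACl (1*6*7*2*4*9*3*5*8)). Qed.

Lemma addr_second_order (V : zmodType) (t j jw s u v : V) :
  - (t + t + (j + jw)) + (t + (s + u) + (t + (s + u)) - (j + v)) = 0 ->
  s - j + (s - j) = jw + v - (u + u).
Proof.
move=> E; apply/eqP; rewrite -subr_eq0 -E; apply/eqP.
rewrite !opprD !opprK !addrA.
by rewrite [RHS](ACl (1*5*2*8*6*3*9*11*4*12*7*10)) /= !(addNr, add0r).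
Qed.

(** * Jordan and triple products *)

Section Algebra.
Variables (R : realType) (A : cstarAlgType R).
Implicit Types (a b c h x y z : A).

Lemma scale_half_double x : (2^-1 : R[i]) *: x + (2^-1 : R[i]) *: x = x.
Proof.
by rewrite -scalerDl -[RHS]scale1r [in RHS](splitr 1) mul1r.
Qed.

Lemma double_inj : injective (fun x : A => x + x).
Proof.
move=> x y /= E.
by rewrite -(scale_half_double x) -scalerDr E scalerDr scale_half_double.
Qed.

Definition jordan x y : A := x * y + y * x.

Lemma jordanC x y : jordan x y = jordan y x.
Proof. by rewrite /jordan addrC. Qed.

Lemma jordan1r x : jordan x 1 = x + x.
Proof. by rewrite /jordan mulr1 mul1r. Qed.

Fact jordan_is_linear h : linear (jordan h).
Proof.
move=> k x y; rewrite /jordan mulrDl mulrDr scalerDr addrACA.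
by rewrite -cstar_scalerAr -cstar_scalerAl.
Qed.
HB.instance Definition _ h :=
  GRing.isLinear.Build R[i] A A _ (jordan h) (@jordan_is_linear h).

Lemma jordanDl x y z : jordan (x + y) z = jordan x z + jordan y z.
Proof. by rewrite jordanC raddfD /= !(jordanC z). Qed.

Lemma jordanNl x y : jordan (- x) y = - jordan x y.
Proof. by rewrite jordanC raddfN /= (jordanC y). Qed.

Lemma ler_norm_jordan x y : `|jordan x y| <= (`|x| * `|y|) *+ 2.
Proof.
apply: le_trans (ler_normD _ _) _; rewrite mulr2n.
by rewrite lerD ?cstar_normrM // mulrC cstar_normrM.
Qed.

(** The relation reads 2u = yu + uy, where the right-hand side has norm at most
    the norm of u. This settles the compatibility with the involution exactly,
    without a passage to the limit. *)
Lemma jordan_1sub_eq0 y u : `|y| <= 2^-1 -> jordan (1 - y) u = 0 -> u = 0.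
Proof.
move=> hy; rewrite jordanDl jordanNl jordanC jordan1r => /subr0_eq E.
have : `|u| *+ 2 <= (`|y| * `|u|) *+ 2.
  by rewrite -normrMn mulr2n E ler_norm_jordan.
rewrite ler_pMn2r // => le_u.
have : `|u| <= `|u| / 2.
  by apply: le_trans le_u _; rewrite mulrC ler_wpM2l.
rewrite -subr_le0 {1}(splitr `|u|) addrK => u2.
apply/eqP; rewrite -normr_le0.
by move: u2; rewrite pmulr_lle0.
Qed.

Lemma star1 : star (1 : A) = 1.
Proof. by rewrite -[LHS]mulr1 -{2}(starK (1 : A)) -starM mulr1 starK. Qed.

Lemma starN x : star (- x) = - star x.
Proof. by rewrite -scaleN1r starZ rmorphN1 scaleN1r. Qed.

Lemma star0 : star (0 : A) = 0.
Proof. by rewrite -(scale0r (0 : A)) starZ conjC0 !scale0r. Qed.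

Lemma star_jordan x y : star (jordan x y) = jordan (star x) (star y).
Proof. by rewrite /jordan starD !starM addrC. Qed.

Definition triple_sum x y z : A := x * y * z + z * y * x.

Lemma triple_sumE a b c :
  triple_product a b c + triple_product a b c = triple_sum a (star b) c.
Proof. exact: scale_half_double. Qed.

Lemma triple_sumN2 a b c : triple_sum a (- b) c = - triple_sum a b c.
Proof. by rewrite /triple_sum !(mulrN, mulNr) opprD. Qed.

Lemma triple_sum1r x y : triple_sum x y 1 = jordan x y.
Proof. by rewrite /triple_sum mul1r mulr1. Qed.

(** The Leibniz rule of f at a single triple. Being a triple derivation, or one
    at z, is this condition over all triples, or over those with product z. *)
Definition leibniz_on (f : A -> A) a b c :=
  f (triple_product a b c) =
    triple_product (f a) b c + triple_product a (f b) c
    + triple_product a b (f c).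

(** Twice the right-hand side of the Leibniz rule. *)
Definition leibniz_sum (f : A -> A) a b c : A :=
  triple_sum (f a) (star b) c + triple_sum a (star (f b)) c
    + triple_sum a (star b) (f c).

Lemma leibniz_onP (f : A -> A) a b c :
  leibniz_on f a b c <->
  f (triple_product a b c) + f (triple_product a b c) = leibniz_sum f a b c.
Proof.
rewrite /leibniz_on /leibniz_sum -!triple_sumE addr_double3.
by split=> [->|/double_inj].
Qed.

Lemma triple_sumBl x y a b :
  triple_sum (x - y) a b =
  triple_sum x a b - triple_sum y a b.
Proof. by rewrite /triple_sum !(mulrBl, mulrBr) opprD addrACA. Qed.

Lemma triple_sumBm x y a b :
  triple_sum a (x - y) b =
  triple_sum a x b - triple_sum a y b.
Proof. by rewrite /triple_sum !(mulrBl, mulrBr) opprD addrACA. Qed.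

Lemma triple_sumBr x y a b :
  triple_sum a b (x - y) =
  triple_sum a b x - triple_sum a b y.
Proof. by rewrite /triple_sum !(mulrBl, mulrBr) opprD addrACA. Qed.

Lemma leibniz_sumB (f g : A -> A) a b c :
  leibniz_sum (f \- g) a b c = leibniz_sum f a b c - leibniz_sum g a b c.
Proof.
rewrite /leibniz_sum /= starD starN triple_sumBl triple_sumBm triple_sumBr.
by rewrite addrB3.
Qed.

Lemma leibniz_onB (f g : A -> A) a b c :
  leibniz_on g a b c -> leibniz_on (f \- g) a b c <-> leibniz_on f a b c.
Proof.
move=> /leibniz_onP lg; rewrite !leibniz_onP leibniz_sumB -lg /= addrACA -opprD.
by split=> [/addIr|->].
Qed.

(** Skewness turns h o b into -(h o b* ) in the middle slot, and with this sign
    the inner terms xhyz and xyhz cancel in each monomial. *)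
Lemma inner_leibniz h a b c : star h = - h -> leibniz_on (jordan h) a b c.
Proof.
move=> skew; apply/leibniz_onP; rewrite -raddfD triple_sumE /leibniz_sum.
rewrite star_jordan skew jordanNl triple_sumN2; move: (star b) => {}b.
have monomial x y z :
    jordan h x * y * z - x * jordan h y * z + x * y * jordan h z =
    jordan h (x * y * z).
  rewrite /jordan !(mulrDl, mulrDr) !mulrA opprD !addrA.
  by rewrite addrK subrK.
rewrite {1}/triple_sum raddfD /= -!monomial.
exact: addr_alternating.
Qed.

(** The triple product of a special Jordan algebra in terms of its Jordan
    product. *)
Lemma jordan_triple_sum a b c :
  triple_sum a b c + triple_sum a b c =
  jordan (jordan a b) c + jordan (jordan b c) a - jordan (jordan a c) b.
Proof.
rewrite /triple_sum /jordan !(mulrDl, mulrDr) !mulrA.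
apply/eqP; rewrite eq_sym subr_eq; apply/eqP.
by rewrite !addrA [LHS](ACl (1*4*7*6*8*3*2*5)).
Qed.

Lemma jordan_derivation_leibniz (d : {additive A -> A}) :
  (forall x, d (star x) = star (d x)) ->
  (forall x y, d (jordan x y) = jordan (d x) y + jordan x (d y)) ->
  forall a b c, leibniz_on d a b c.
Proof.
move=> dstar dJ a b c; apply/leibniz_onP.
rewrite -raddfD triple_sumE /leibniz_sum -dstar; move: (star b) => {}b.
apply: double_inj; rewrite -raddfD jordan_triple_sum raddfB raddfD /= !dJ.
rewrite !(jordanDl (jordan _ _)) -addr_double3 !jordan_triple_sum.
exact: addr_leibniz9.
Qed.

Lemma triple_product_at1 a b :
  jordan a (star b) = 1 + 1 -> triple_product a b 1 = 1.
Proof. by move=> E; apply: double_inj; rewrite triple_sumE triple_sum1r. Qed.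

(** * Linear maps that are triple derivations at 1 *)

Definition star_conj (f : A -> A) x : A := star (f (star x)).

Section AtOne.
Variable T : {linear A -> A}.
Hypothesis T_at1 : triple_derivation_at T 1.

Lemma leibniz_sum_at1 a b c :
  triple_product a b c = 1 -> leibniz_sum T a b c = T 1 + T 1.
Proof.
move=> abc; have := T_at1 abc; rewrite -{1}abc => /leibniz_onP <-.
by rewrite abc.
Qed.

Lemma at1_skew : star (T 1) = - T 1.
Proof.
have t111 : triple_product (1 : A) 1 1 = 1.
  by apply: triple_product_at1; rewrite star1 jordan1r.
have := leibniz_sum_at1 t111.
rewrite /leibniz_sum star1 /triple_sum !(mulr1, mul1r) => E.
have /addr0_eq : T 1 + T 1 + (star (T 1) + star (T 1)) = 0.
  by apply: (addrI (T 1 + T 1)); rewrite addr0 addrA addrAC.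
by rewrite opprD => kE; apply: double_inj.
Qed.

Hypothesis T1 : T 1 = 0.

(** The Leibniz rule at {a, 1, r} = 1. *)
Lemma at1_inverse a r : a * r = 1 -> r * a = 1 ->
  jordan (T a) r + jordan a (T r) = 0.
Proof.
move=> ar ra.
have t : triple_product a 1 r = 1.
  by apply: double_inj; rewrite triple_sumE /triple_sum star1 !mulr1 ar ra.
have := leibniz_sum_at1 t.
by rewrite /leibniz_sum star1 T1 star0 /triple_sum !mulr1 !mulr0 !mul0r !addr0.
Qed.

(** The Leibniz rule at {a, r*, 1} = 1. *)
Lemma at1_inverse_star_conj a r : a * r = 1 -> r * a = 1 ->
  jordan (T a) r + jordan a (star_conj T r) = 0.
Proof.
move=> ar ra.
have t : triple_product a (star r) 1 = 1.
  by apply: triple_product_at1; rewrite starK /jordan ar ra.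
have := leibniz_sum_at1 t.
by rewrite /leibniz_sum starK T1 !triple_sum1r /triple_sum !mulr0 !mul0r !addr0.
Qed.

(** Exchanging a and r in the two relations above and subtracting shows that r,
    and not yet a, annihilates the difference; multiplying ru + ur = 0 by a on
    both sides moves the statement to a. *)
Lemma jordan_star_conj_unit a r : a * r = 1 -> r * a = 1 ->
  jordan a (star_conj T a - T a) = 0.
Proof.
move=> ar ra; set u := _ - _.
have /(congr1 (fun v => a * v * a)) : jordan r u = 0.
  rewrite /u raddfB /=; apply/eqP; rewrite subr_eq0; apply/eqP.
  apply: (addrI (jordan (T r) a)).
  by rewrite at1_inverse // at1_inverse_star_conj.
rewrite mulr0 mul0r {1}/jordan mulrDr mulrDl !mulrA ar mul1r.
by rewrite -mulrA ra mulr1 addrC.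
Qed.

Lemma at1_star x : T (star x) = star (T x).
Proof.
suff small y : `|y| <= 2^-1 -> T (star y) = star (T y).
  have [t t0 /small] := small_multiple x.
  rewrite starZ !linearZ /= starZ => /scalerI -> //.
  by rewrite conjC_eq0.
move=> hy; have [r [yr ry _]] := neumann hy.
have := jordan_star_conj_unit yr ry => /(jordan_1sub_eq0 hy).
rewrite /star_conj starD star1 starN !raddfB /= T1 !sub0r starN oppr0 add0r.
by move=> /subr0_eq /oppr_inj <-; rewrite starK.
Qed.

Variable M : R[i].
Hypothesis M0 : 0 <= M.
Hypothesis TM : forall x, `|T x| <= M * `|x|.

(** With r the inverse of 1 - y and w = y^2 r, the expansion r = 1 + y + w turns
    the relation of [at1_inverse] into an expression of twice
    T(y^2) - (T(y) y + y T(y)) by terms of third order. *)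
Lemma at1_jordan_square y : T (y * y) = jordan (T y) y.
Proof.
apply/eqP; rewrite -subr_eq0; apply/eqP; move: y.
(* Three terms, each at most M |y| |w|, where |w| <= 2 |1| |y|^2. *)
apply: (@homogeneous_vanish R A A 2 _ (M * `|1 : A| * 6)).
- by rewrite !mulr_ge0.
- move=> t x; rewrite !linearZ /= (jordanC (t *: _)) linearZ /= jordanC.
  rewrite -cstar_scalerAl -cstar_scalerAr !linearZ /= jordanC.
  by rewrite -!scalerDr scalerA.
move=> y hy; have [r [yr ry rb]] := neumann hy.
have := at1_inverse yr ry.
have rE : r = 1 + y * r by apply/eqP; rewrite -subr_eq -{1}(mul1r r) -mulrBl yr.
set w := y * y * r.
have yrE : y * r = y + w by rewrite {1}rE mulrDr mulr1 mulrA.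
rewrite yrE in rE.
have wE : T w = T (y * y) + T (y * w).
  by rewrite -raddfD -mulrDr -yrE mulrA.
have w_bound : `|w| <= `|y| ^+ 2 * (`|1 : A| * 2).
  apply: le_trans (cstar_normrM _ _) _.
  apply: ler_pM => //; exact: cstar_normrM.
have -> : T (1 - y) = - T y by rewrite raddfB /= T1 sub0r.
have -> : T r = T y + T w by rewrite rE !raddfD /= T1 add0r.
rewrite jordanNl jordanDl jordanNl (jordanC 1) jordan1r.
have -> : jordan (T y) r = T y + T y + (jordan (T y) y + jordan (T y) w).
  by rewrite rE !raddfD /= jordan1r.
rewrite (raddfD (jordan y)) /= (jordanC y (T y)) {1 2}wE.
set G := T (y * y) - _ => G2.
have {}G2 : G + G = jordan (T y) w + jordan y (T w) - (T (y * w) + T (y * w)).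
  by rewrite /G; move: G2; exact: addr_second_order.
have : `|G| *+ 2 <=
    (`|T y| * `|w|) *+ 2 + (`|y| * `|T w|) *+ 2 + `|T (y * w)| *+ 2.
  rewrite -normrMn mulr2n G2.
  apply: le_trans (ler_normB _ _) _; rewrite lerD //.
    by apply: le_trans (ler_normD _ _) _; rewrite lerD // ler_norm_jordan.
  by rewrite -mulr2n normrMn.
rewrite -!mulrnDl ler_pMn2r // => Gle.
apply: le_trans Gle _.
set B := M * `|1 : A| * 2 * `|y| ^+ 3.
have bound3 (u : R[i]) : u <= M * (`|y| * `|w|) -> u <= B.
  move=> /le_trans; apply; rewrite /B -!mulrA ler_wpM2l //.
  by rewrite mulrA [leRHS]mulrC exprS -mulrA ler_wpM2l.
have -> : M * `|1 : A| * 6 * `|y| ^+ 3 = B + B + B by rewrite /B; ring.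
rewrite lerD // ?lerD // bound3 //.
- by rewrite mulrA ler_wpM2r.
- by rewrite mulrCA ler_wpM2l.
- by apply: le_trans (TM _) _; rewrite ler_wpM2l ?cstar_normrM.
Qed.

(** Polarization of [at1_jordan_square]. *)
Lemma at1_jordan x y : T (jordan x y) = jordan (T x) y + jordan x (T y).
Proof.
have := at1_jordan_square (x + y).
have -> : (x + y) * (x + y) = x * x + jordan x y + y * y.
  by rewrite /jordan mulrDl !mulrDr !addrA.
rewrite (raddfD T (x * x + jordan x y)) (raddfD T (x * x)) (raddfD T x) /=.
rewrite (jordanDl (T x)) (raddfD (jordan (T x))) (raddfD (jordan (T y))) /=.
rewrite !at1_jordan_square [in RHS]addrA => /addIr.
by rewrite -(addrA (jordan (T x) x)) => /addrI ->; rewrite (jordanC x).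
Qed.

End AtOne.

(** * Reduction to maps that vanish at 1 *)

Section Reduction.
Variable T : {linear A -> A}.
Hypothesis T_at1 : triple_derivation_at T 1.
Hypothesis T_cont : continuous T.

(* Half of T 1, because [jordan h] is the doubled Jordan product. *)
Let h := (2^-1 : R[i]) *: T 1.
Let D : {linear A -> A} := T \- jordan h.

Lemma at1_half_skew : star h = - h.
Proof.
by rewrite /h starZ at1_skew // scalerN fmorphV rmorph_nat.
Qed.

Lemma reduced_at1 : triple_derivation_at D 1.
Proof.
move=> a b c abc; rewrite -abc; apply/leibniz_onB.
  exact: inner_leibniz at1_half_skew.
by rewrite /leibniz_on abc; apply: T_at1.
Qed.

Lemma reduced1 : D 1 = 0.
Proof. by rewrite /D /= jordan1r /h scale_half_double subrr. Qed.

Lemma reduced_bounded :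
  exists2 M : R[i], 0 <= M & forall x, `|D x| <= M * `|x|.
Proof.
have /linear_bounded_continuous/linear_boundedP := T_cont.
move=> [M [Mreal MT]].
have TM x : `|T x| <= (`|M| + 1) * `|x|.
  by apply: MT; rewrite ltr_pwDr // real_ler_norm.
exists (`|M| + 1 + `|h| *+ 2) => [|x].
  by rewrite !addr_ge0 ?mulrn_wge0.
apply: le_trans (ler_normB _ _) _; rewrite mulrDl lerD //.
by rewrite mulrnAl ler_norm_jordan.
Qed.

Lemma at1_leibniz a b c : leibniz_on T a b c.
Proof.
apply/(leibniz_onB _ (inner_leibniz a b c at1_half_skew)).
have [M M0 DM] := reduced_bounded.
apply: (@jordan_derivation_leibniz D) => [x|x y].
  exact: at1_star reduced_at1 reduced1 x.
have DJ := at1_jordan reduced_at1 reduced1 M0 DM.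
exact: DJ.
Qed.

End Reduction.

End Algebra.

Theorem corollary2p5 (R : realType) (A : cstarAlgType R) (T : {linear A -> A}) :
  continuous T -> triple_derivation_at T 1 -> triple_derivation T.
Proof. by move=> T_cont T_at1 a b c; apply: at1_leibniz. Qed.
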